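(* Let $K$ be a field and let $\mathcal{A}$ be a countable dimensional unital $K$-algebra. Then the nonzero idempotents of the Fredholm extension $\mathrm{Fred}(\mathcal{A})$ are in bijective correspondence with the endclasses of $\mathcal{A}$.
   Context: A $K$-linear subspace $V\subset\mathcal{A}$ is called almost invariant if for every $x\in\mathcal{A}$ the quotient $(Vx+V)/V$ is finite dimensional over $K$. Endclasses: consider decompositions $\mathcal{A}=V\oplus W$ (as ordered pairs $(V,W)$) into the direct sum of two almost invariant subspaces, where $V$ is infinite dimensional ($W$ may be finite dimensional, including zero). Two such decompositions $\mathcal{A}=V\oplus W$ and $\mathcal{A}=V'\oplus W'$ are equivalent if $(V+V')/V$, $(V+V')/V'$, $(W+W')/W$ and $(W+W')/W'$ are all finite dimensional. The equivalence classes of such decompositions are the endclasses of $\mathcal{A}$. Fredholm extension: for $x\in\mathcal{A}$ let $r_x\in\mathrm{End}_K(\mathcal{A})$ denote right multiplication by $x$, $r_x(a)=ax$. Let $I\subset\mathrm{End}_K(\mathcal{A})$ be the ideal of $K$-linear endomorphisms of finite rank. Put $$\widetilde{\mathcal{A}}=\{T\in\mathrm{End}_K(\mathcal{A})\mid Tr_x-r_xT\in I\text{ for all }x\in\mathcal{A}\},$$ a unital subalgebra of $\mathrm{End}_K(\mathcal{A})$ containing $I$, and $\mathrm{Fred}(\mathcal{A})=\widetilde{\mathcal{A}}/I$. *)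

(* Defs.v *)
From HB Require Import structures.
From mathcomp Require Import all_boot all_algebra.
From mathcomp Require Import boolp classical_sets functions cardinality.

Set Implicit Arguments.
Unset Strict Implicit.
Unset Printing Implicit Defensive.

Import GRing.Theory.

Local Open Scope classical_set_scope.
Local Open Scope quotient_scope.
Local Open Scope ring_scope.

(* Subspaces of a possibly infinite dimensional vector space are represented
   by classical sets; [vector.v] only covers finite dimensional spaces. *)
Section LinearAlgebra.
Variables (K : fieldType) (E : lmodType K).
Implicit Types (U V W : set E) (s : seq E).

Definition subspace U := GRing.submod_closed [in U].

Definition sum_set U V : set E := [set u + v | u in U & v in V].

Definition span s : set E :=
  [set \sum_(i < size s) c i *: s`_i | c in [set: nat -> K]].

Definition free_set (B : set E) := forall s, uniq s -> [set` s] `<=` B ->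
  forall c : nat -> K, \sum_(i < size s) c i *: s`_i = 0 ->
  forall i, (i < size s)%N -> c i = 0.

Definition generating_set (B : set E) :=
  forall u, exists2 s, [set` s] `<=` B & span s u.

Definition countable_dim :=
  exists B : set E, [/\ countable B, free_set B & generating_set B].

(* The quotient U/V is finite dimensional: it is spanned by the classes of
   finitely many elements of U.  Meaningful for subspaces V `<=` U. *)
Definition fdim_quot U V := exists2 s : seq E, [set` s] `<=` U &
  forall u, U u -> exists2 w, span s w & V (u - w).

Definition fdim U := fdim_quot U [set 0].

Definition direct_sum V W := sum_set V W = setT /\ V `&` W = [set 0].

Lemma subspace0 U : subspace U -> U 0.
Proof. by case=> h _; apply: set_mem h. Qed.

Lemma subspaceP U a u v : subspace U -> U u -> U v -> U (a *: u + v).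
Proof.
case=> _ h Uu Uv; apply: set_mem (h a u v (mem_set Uu) (mem_set Uv)).
Qed.

Lemma subspaceI U : U 0 -> (forall a u v, U u -> U v -> U (a *: u + v)) ->
  subspace U.
Proof.
move=> U0 h; split; first exact: mem_set U0.
by move=> a u v /set_mem Uu /set_mem Uv; apply: mem_set; apply: h.
Qed.

Lemma subspaceD U u v : subspace U -> U u -> U v -> U (u + v).
Proof. by move=> sU Uu Uv; rewrite -[u]scale1r; apply: subspaceP. Qed.

Lemma subspaceZ U a u : subspace U -> U u -> U (a *: u).
Proof.
by move=> sU Uu; rewrite -[_ *: _]addr0; apply: subspaceP => //; apply: subspace0.
Qed.

Lemma subspaceB U u v : subspace U -> U u -> U v -> U (u - v).
Proof. by move=> sU Uu Uv; rewrite addrC -scaleN1r; apply: subspaceP. Qed.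

Lemma subspace_sum_set U V : subspace U -> subspace V -> subspace (sum_set U V).
Proof.
move=> sU sV; apply: subspaceI.
  by exists 0; [exact: subspace0|exists 0; [exact: subspace0|rewrite addr0]].
move=> a _ _ [u Uu [v Vv <-]] [u' Uu' [v' Vv' <-]].
exists (a *: u + u'); first exact: subspaceP.
exists (a *: v + v'); first exact: subspaceP.
by rewrite scalerDr addrACA.
Qed.

Lemma subspace1 : subspace [set 0].
Proof.
by apply: subspaceI => //= a u v -> ->; rewrite scaler0 addr0.
Qed.

Lemma span_nilE : span [::] = [set 0].
Proof.
rewrite predeqE => u; split; first by case=> c _ <-; rewrite big_ord0.
by move=> ->; exists (fun=> 0) => //; rewrite big_ord0.
Qed.

Lemma span_consP x s u :
  span (x :: s) u <-> exists a w, span s w /\ u = a *: x + w.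
Proof.
split=> [[c _ <-]|[a [_ [[c _ <-] ->]]]].
  exists (c 0%N), (\sum_(i < size s) c i.+1 *: s`_i).
  by rewrite /= big_ord_recl; split=> //; exists (fun i => c i.+1).
exists (fun i => if i is j.+1 then c j else a) => //.
by rewrite /= big_ord_recl.
Qed.

Lemma subspace_span s : subspace (span s).
Proof.
apply: subspaceI.
  by exists (fun=> 0) => //; rewrite big1 // => i _; rewrite scale0r.
move=> a _ _ [c _ <-] [d _ <-]; exists (fun i => a * c i + d i) => //.
rewrite scaler_sumr -big_split; apply: eq_bigr => i _ /=.
by rewrite scalerDl scalerA.
Qed.

Lemma span_cat s t u v : span s u -> span t v -> span (s ++ t) (u + v).
Proof.
elim: s u => [|x s IHs] u /=; first by rewrite span_nilE => -> ; rewrite add0r.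
move=> /span_consP[a [w [sw ->]]] tv; apply/span_consP.
by exists a, (w + v); rewrite addrA; split=> //; apply: IHs.
Qed.

(* The spanning vectors may be taken outside U. *)
Lemma fdim_quotI U V s : subspace U -> subspace V ->
  (forall u, U u -> exists2 w, span s w & V (u - w)) -> fdim_quot U V.
Proof.
move=> + sV; elim: s U => [|x s IHs] U sU hU.
  exists [::]; first by move=> y /=; rewrite in_nil.
  by move=> u /hU.
pose U1 := U `&` [set u | exists2 w, span s w & V (u - w)].
have sU1 : subspace U1.
  apply: subspaceI.
    split; first exact: subspace0.
    by exists 0; [exact: subspace0 (subspace_span s)|rewrite subr0; exact: subspace0].
  move=> a u v [Uu [w sw Vw]] [Uv [w' sw' Vw']]; split; first exact: subspaceP.
  exists (a *: w + w'); first by apply: subspaceP => //; apply: subspace_span.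
  by rewrite opprD addrACA -scalerBr; apply: subspaceP.
have [|t tU1 ht] := IHs U1 sU1; first by move=> u [].
have tU : [set` t] `<=` U by move=> y /tU1[].
have [[u0 [Uu0 [a [w [a0 sw Vw]]]]]|nu] := pselect (exists u0, U u0 /\
    exists a w, [/\ a != 0, span s w & V (u0 - (a *: x + w))]).
  exists (u0 :: t).
    by move=> y /=; rewrite inE => /orP[/eqP->//|]; apply: tU.
  move=> u Uu; have [_ /span_consP[b [w' [sw' ->]]] Vw'] := hU u Uu.
  have U1u : U1 (u - (b / a) *: u0).
    split; first by apply: subspaceB => //; apply: subspaceZ.
    exists (w' - (b / a) *: w).
      apply: subspaceB => //; [exact: subspace_span..|].
      by apply: subspaceZ => //; exact: subspace_span.
    have -> : u - b / a *: u0 - (w' - b / a *: w) =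
        (u - (b *: x + w')) - (b / a) *: (u0 - (a *: x + w)).
      rewrite scalerBr scalerDr scalerA divfK // !opprB opprD [u + (_ - w')]addrA.
      rewrite [_ - _ - w']addrAC -[_ + _ *: w - _]addrA [RHS]addrA addrNK.
      by rewrite addrACA [RHS]addrACA [- w' - _]addrC.
    by apply: subspaceB => //; apply: subspaceZ.
  have [w1 tw1 Vw1] := ht _ U1u.
  exists ((b / a) *: u0 + w1); first by apply/span_consP; exists (b / a), w1.
  by rewrite opprD addrA.
exists t => // u Uu; apply: ht; split=> //.
have [_ /span_consP[b [w' [sw' ->]]] Vw'] := hU u Uu.
have [b0|b0] := eqVneq b 0; first by exists w' => //; rewrite b0 scale0r add0r in Vw'.
by case: nu; exists u; split=> //; exists b, w'.
Qed.

Lemma fdim_quot_sum U V : subspace U -> subspace V ->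
  (exists s, forall v, V v -> exists2 w, span s w & U (v - w)) ->
  fdim_quot (sum_set U V) U.
Proof.
move=> sU sV [s hs]; apply: (@fdim_quotI _ _ s) => //.
  exact: subspace_sum_set.
move=> _ [u Uu [v Vv <-]]; have [w sw Uw] := hs v Vv.
by exists w => //; rewrite -addrA; apply: subspaceD.
Qed.

Lemma fdim_quot_sumP U V : subspace U ->
  fdim_quot (sum_set U V) U ->
  exists s, forall v, V v -> exists2 w, span s w & U (v - w).
Proof.
move=> sU [s _ hs]; exists s => v Vv; apply: hs.
by exists 0; [exact: subspace0|exists v => //; rewrite add0r].
Qed.

Lemma sum_setC U V : sum_set U V = sum_set V U.
Proof.
by rewrite predeqE => x; split=> -[u Uu [v Vv <-]]; exists v => //; exists u;
  rewrite // addrC.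
Qed.

Lemma fdim_quot_trans U V W : subspace U -> subspace V -> subspace W ->
  fdim_quot (sum_set U V) U -> fdim_quot (sum_set V W) V ->
  fdim_quot (sum_set U W) U.
Proof.
move=> sU sV sW /(fdim_quot_sumP sU)[s hs] /(fdim_quot_sumP sV)[t ht].
apply: fdim_quot_sum => //; exists (s ++ t) => w Ww.
have [x tx Vx] := ht w Ww; have [y sy Uy] := hs _ Vx.
exists (y + x); first exact: span_cat.
by rewrite [y + x]addrC opprD addrA.
Qed.

Lemma fdim_quot_refl U : subspace U -> fdim_quot (sum_set U U) U.
Proof.
move=> sU; apply: fdim_quot_sum => //; exists [::] => v Uv.
by exists 0; rewrite ?span_nilE ?subr0.
Qed.

End LinearAlgebra.

Arguments countable_dim {K} E.

(* The ring of K-linear endomorphisms of E, with composition as product. *)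
Definition End (K : fieldType) (E : lmodType K) := {linear E -> E}.

Section EndRing.
Variables (K : fieldType) (E : lmodType K).
Local Notation End := (End E).
Implicit Types S T : End.

HB.instance Definition _ := gen_eqMixin End.
HB.instance Definition _ := gen_choiceMixin End.

Lemma EndP S T : (forall u, S u = T u) -> S = T.
Proof.
case: S T => [f [[Hf] [Hf']]] [g [[Hg] [Hg']]] /= fg.
have {}fg : f = g by apply/funext.
case: _ / fg in Hg Hg' *.
by rewrite (Prop_irrelevance Hf Hg) (Prop_irrelevance Hf' Hg').
Qed.

Definition End_zero : End := \0.
Definition End_opp T : End := \- T.
Definition End_add S T : End := S \+ T.
Definition End_one : End := idfun.
Definition End_mul S T : End := S \o T.

Fact End_addA : associative End_add.
Proof. by move=> S T R; apply: EndP => u /=; rewrite addrA. Qed.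
Fact End_addC : commutative End_add.
Proof. by move=> S T; apply: EndP => u /=; rewrite addrC. Qed.
Fact End_add0 : left_id End_zero End_add.
Proof. by move=> T; apply: EndP => u /=; rewrite add0r. Qed.
Fact End_addN : left_inverse End_zero End_opp End_add.
Proof. by move=> T; apply: EndP => u /=; rewrite addNr. Qed.

HB.instance Definition _ :=
  GRing.isZmodule.Build End End_addA End_addC End_add0 End_addN.

Fact End_mulA : associative End_mul.
Proof. by move=> S T R; apply: EndP. Qed.
Fact End_mul1 : left_id End_one End_mul.
Proof. by move=> T; apply: EndP. Qed.
Fact End_1mul : right_id End_one End_mul.
Proof. by move=> T; apply: EndP. Qed.
Fact End_mulDl : left_distributive End_mul +%R.
Proof. by move=> S T R; apply: EndP. Qed.
Fact End_mulDr : right_distributive End_mul +%R.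
Proof. by move=> S T R; apply: EndP => u; rewrite /= raddfD. Qed.

HB.instance Definition _ := GRing.Zmodule_isPzRing.Build End
  End_mulA End_mul1 End_1mul End_mulDl End_mulDr.

Lemma EndME S T u : (S * T) u = S (T u). Proof. by []. Qed.
Lemma EndBE S T u : (S - T) u = S u - T u. Proof. by []. Qed.
Lemma EndDE S T u : (S + T) u = S u + T u. Proof. by []. Qed.
Lemma End1E u : (1 : End) u = u. Proof. by []. Qed.
Lemma End0E u : (0 : End) u = 0. Proof. by []. Qed.

Definition finite_rank T := fdim (range T).

Lemma subspace_range T : subspace (range T).
Proof.
apply: subspaceI; first by exists 0; rewrite ?raddf0.
by move=> a _ _ [u _ <-] [v _ <-]; exists (a *: u + v); rewrite ?linearP.
Qed.

Lemma finite_rankP T : finite_rank T <-> exists s, forall u, span s (T u).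
Proof.
split=> [[s _ hs]|[s hs]].
  exists s => u; have [|w sw /eqP] := hs (T u); first by exists u.
  by rewrite subr_eq0 => /eqP->.
apply: (@fdim_quotI _ _ _ _ s) => [||_ [u _ <-]].
- exact: subspace_range.
- exact: subspace1.
by exists (T u); rewrite ?subrr.
Qed.

Lemma finite_rank0 : finite_rank 0.
Proof. by apply/finite_rankP; exists [::] => u; rewrite span_nilE. Qed.

Lemma finite_rankD S T : finite_rank S -> finite_rank T -> finite_rank (S + T).
Proof.
move=> /finite_rankP[s hs] /finite_rankP[t ht]; apply/finite_rankP.
by exists (s ++ t) => u; rewrite EndDE; apply: span_cat.
Qed.

Lemma finite_rankMr S T : finite_rank S -> finite_rank (S * T).
Proof.
move=> /finite_rankP[s hs]; apply/finite_rankP.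
by exists s => u; rewrite EndME.
Qed.

Lemma finite_rankMl S T : finite_rank T -> finite_rank (S * T).
Proof.
move=> /finite_rankP[s hs]; apply/finite_rankP.
exists (map S s) => u; rewrite EndME; have [c _ <-] := hs u.
exists c => //; rewrite size_map raddf_sum; apply: eq_bigr => i _.
by rewrite (nth_map 0) //= linearZ.
Qed.

Lemma finite_rankB S T : finite_rank S -> finite_rank T -> finite_rank (S - T).
Proof. by move=> hS hT; rewrite -mulN1r; apply: finite_rankD (finite_rankMl _ hT). Qed.

End EndRing.

Section FredholmExtension.
Variables (K : fieldType) (A : algType K).

Definition rmul (x : A) : End A := x \o* idfun.

Definition tilde_pred : {pred End A} :=
  [pred T | `[< forall x, finite_rank (T * rmul x - rmul x * T) >]].

Lemma tildeP T : reflect (forall x, finite_rank (T * rmul x - rmul x * T))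
  (T \in tilde_pred).
Proof. exact: asboolP. Qed.

Fact tilde_subring_closed : subring_closed tilde_pred.
Proof.
split=> [|S T /tildeP hS /tildeP hT|S T /tildeP hS /tildeP hT];
  apply/tildeP => x.
- by rewrite mul1r mulr1 subrr; apply: finite_rank0.
- have -> : (S - T) * rmul x - rmul x * (S - T) =
    (S * rmul x - rmul x * S) - (T * rmul x - rmul x * T).
    rewrite mulrBl mulrBr !opprB addrACA [RHS]addrACA.
    by congr (_ + _); rewrite addrC.
  exact: finite_rankB.
have -> : S * T * rmul x - rmul x * (S * T) =
  S * (T * rmul x - rmul x * T) + (S * rmul x - rmul x * S) * T.
  by rewrite mulrBr mulrBl !mulrA addrA addrNK.
by apply: finite_rankD; [apply: finite_rankMl|apply: finite_rankMr].
Qed.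

HB.instance Definition _ :=
  GRing.isSubringClosed.Build (End A) tilde_pred tilde_subring_closed.

Definition tilde := {T : End A | T \in tilde_pred}.
HB.instance Definition _ := SubChoice.on tilde.
HB.instance Definition _ :=
  GRing.SubChoice_isSubPzRing.Build (End A) tilde_pred tilde
    tilde_subring_closed.

Definition finite_rank_ideal : {pred tilde} :=
  [pred T | `[< finite_rank (val T) >]].

Lemma finite_rank_idealP (T : tilde) :
  reflect (finite_rank (val T)) (T \in finite_rank_ideal).
Proof. exact: asboolP. Qed.

Lemma finite_rank_tilde (T : End A) : finite_rank T -> T \in tilde_pred.
Proof.
move=> hT; apply/tildeP => x.
by apply: finite_rankB; [apply: finite_rankMr|apply: finite_rankMl].
Qed.

Fact finite_rank_zmod_closed : zmod_closed finite_rank_ideal.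
Proof.
split=> [|S T /finite_rank_idealP hS /finite_rank_idealP hT];
  apply/finite_rank_idealP; first by rewrite raddf0; apply: finite_rank0.
by rewrite raddfB; apply: finite_rankB.
Qed.

HB.instance Definition _ :=
  GRing.isZmodClosed.Build tilde finite_rank_ideal finite_rank_zmod_closed.

(* Only commutative ring quotients are available in [ring_quotient.v]; the
   product is added here to the additive quotient. *)
Definition Fred := {ideal_quot finite_rank_ideal}.
HB.instance Definition _ := GRing.Zmodule.on Fred.
HB.instance Definition _ := EqQuotient.on Fred.

Definition Fred_one : Fred := \pi_Fred 1.
Definition Fred_mul (e f : Fred) : Fred := \pi_Fred (repr e * repr f).

Lemma Fred_eqP (S T : tilde) :
  reflect (finite_rank (val S - val T)) (\pi_Fred S == \pi_Fred T).
Proof.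
rewrite -Quotient.idealrBE -raddfB; exact: finite_rank_idealP.
Qed.

Lemma pi_FredM (S T : tilde) : \pi_Fred (S * T) = Fred_mul (\pi_Fred S) (\pi_Fred T).
Proof.
have hr (R : tilde) : finite_rank (val R - val (repr (\pi_Fred R))).
  by apply/Fred_eqP; rewrite reprK.
apply/eqP/Fred_eqP; rewrite !rmorphM /=.
set S' := sval (repr _); set T' := sval (repr (\pi_Fred T)).
have -> : sval S * sval T - S' * T' =
    sval S * (sval T - T') + (sval S - S') * T'.
  by rewrite mulrBr mulrBl addrA addrNK.
apply: finite_rankD.
  by apply: finite_rankMl; apply: hr.
by apply: finite_rankMr; apply: hr.
Qed.

Lemma Fred_surj (e : Fred) : exists T, e = \pi_Fred T.
Proof. by exists (repr e); rewrite reprK. Qed.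

Lemma pi_FredD (S T : tilde) : \pi_Fred (S + T) = \pi_Fred S + \pi_Fred T.
Proof. exact: Quotient.pi_add. Qed.

Fact Fred_mulA : associative Fred_mul.
Proof.
move=> e f g; have [S ->] := Fred_surj e; have [T ->] := Fred_surj f.
by have [R ->] := Fred_surj g; rewrite -!pi_FredM mulrA.
Qed.
Fact Fred_mul1 : left_id Fred_one Fred_mul.
Proof. by move=> e; have [S ->] := Fred_surj e; rewrite -pi_FredM mul1r. Qed.
Fact Fred_1mul : right_id Fred_one Fred_mul.
Proof. by move=> e; have [S ->] := Fred_surj e; rewrite -pi_FredM mulr1. Qed.
Fact Fred_mulDl : left_distributive Fred_mul +%R.
Proof.
move=> e f g; have [S ->] := Fred_surj e; have [T ->] := Fred_surj f.
by have [R ->] := Fred_surj g; rewrite -pi_FredD -!pi_FredM -pi_FredD mulrDl.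
Qed.
Fact Fred_mulDr : right_distributive Fred_mul +%R.
Proof.
move=> e f g; have [S ->] := Fred_surj e; have [T ->] := Fred_surj f.
by have [R ->] := Fred_surj g; rewrite -pi_FredD -!pi_FredM -pi_FredD mulrDr.
Qed.

HB.instance Definition _ := GRing.Zmodule_isPzRing.Build Fred
  Fred_mulA Fred_mul1 Fred_1mul Fred_mulDl Fred_mulDr.

Definition nonzero_idempotent := {e : Fred | (e != 0) && (e * e == e)}.

End FredholmExtension.

Section Endclasses.
Variables (K : fieldType) (A : algType K).

Definition right_translate (V : set A) (x : A) : set A := [set v * x | v in V].

Definition almost_invariant (V : set A) := subspace V /\
  forall x, fdim_quot (sum_set (right_translate V x) V) V.

Record decomposition := Decomposition {
  dec1 : set A;
  dec2 : set A;
  dec1_almost_invariant : almost_invariant dec1;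
  dec2_almost_invariant : almost_invariant dec2;
  dec_direct_sum : direct_sum dec1 dec2;
  dec1_infinite : ~ fdim dec1 }.

HB.instance Definition _ := gen_eqMixin decomposition.
HB.instance Definition _ := gen_choiceMixin decomposition.

Definition dec_equiv (D D' : decomposition) :=
  [/\ fdim_quot (sum_set (dec1 D) (dec1 D')) (dec1 D),
      fdim_quot (sum_set (dec1 D) (dec1 D')) (dec1 D'),
      fdim_quot (sum_set (dec2 D) (dec2 D')) (dec2 D) &
      fdim_quot (sum_set (dec2 D) (dec2 D')) (dec2 D')].

Fact dec_equiv_class : equiv_class_of (fun D D' => `[< dec_equiv D D' >]).
Proof.
have sub1 D : subspace (dec1 D) by case: (dec1_almost_invariant D).
have sub2 D : subspace (dec2 D) by case: (dec2_almost_invariant D).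
split=> [D|D D'|D' D D''].
- by apply/asboolP; split; apply: fdim_quot_refl.
- by apply/idP/idP => /asboolP[h1 h2 h3 h4]; apply/asboolP; split;
    rewrite sum_setC.
move=> /asboolP[h1 h2 h3 h4] /asboolP[k1 k2 k3 k4]; apply/asboolP.
split; [|rewrite sum_setC| |rewrite sum_setC].
- exact: fdim_quot_trans h1 k1.
- by apply: (@fdim_quot_trans _ _ _ (dec1 D')); rewrite // sum_setC.
- exact: fdim_quot_trans h3 k3.
by apply: (@fdim_quot_trans _ _ _ (dec2 D')); rewrite // sum_setC.
Qed.

Canonical dec_equiv_rel := EquivRelPack dec_equiv_class.

Definition endclass := {eq_quot dec_equiv_rel}.

End Endclasses.

(* Main.v *)
(* An idempotent P of End(A) is the same thing as a decomposition of A into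
   range P and range (1 - P), and P commutes with every r_x modulo finite rank
   iff both summands are almost invariant, since
   P r_x - r_x P = P r_x (1 - P) - (1 - P) r_x P and the two terms on the right
   measure the failure of almost invariance of the summands.  In the same way
   P - P' = P (1 - P') - (1 - P) P' shows that two decompositions are
   equivalent iff their projections agree modulo finite rank.  It remains to
   lift an idempotent of Fred(A): if T^2 - T has finite rank, then
   U = ker (T^2 - T) is T-stable of finite codimension, so it has a finite
   dimensional complement, and if Q is a projection onto U then T Q is an
   idempotent congruent to T. *)
Require Import Defs.
From HB Require Import structures.
From mathcomp Require Import all_boot all_algebra.
From mathcomp Require Import boolp classical_sets functions cardinality.
Import Defs.

Set Implicit Arguments.
Unset Strict Implicit.
Unset Printing Implicit Defensive.

Import GRing.Theory.

Local Open Scope classical_set_scope.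
Local Open Scope quotient_scope.
Local Open Scope ring_scope.

(** * Projections, complements and finite rank *)

Section Projections.
Variables (K : fieldType) (E : lmodType K).
Implicit Types (U V W : set E) (P S T N : End E).

(** The component in [V] is unique because [V] and [W] meet in 0, so the function obtained by choice
    is automatically linear. *)
Lemma direct_sum_projection V W : subspace V -> subspace W ->
  direct_sum V W -> exists P, forall u, V (P u) /\ W (u - P u).
Proof.
move=> sV sW [VWT VW0].
have decP u : exists v, V v /\ W (u - v).
  have : sum_set V W u by rewrite VWT.
  by move=> [v Vv [w Ww <-]]; exists v; rewrite addrC addKr.
have dec_uniq v v' u : V v -> W (u - v) -> V v' -> W (u - v') -> v = v'.
  move=> Vv Wv Vv' Wv'; apply/eqP; rewrite -subr_eq0; apply/eqP.
  have : (V `&` W) (v - v').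
    split; first exact: subspaceB.
    have -> : v - v' = (u - v') - (u - v) by rewrite opprB [RHS]addrC subrKA.
    exact: subspaceB.
  by rewrite VW0.
have [p hp] := choice decP.
have p_lin : linear p.
  move=> a u v; have [Vu Wu] := hp u; have [Vv Wv] := hp v.
  have [Vw Ww] := hp (a *: u + v).
  apply: dec_uniq Vw Ww _ _; first exact: subspaceP.
  by rewrite opprD addrACA -scalerBr; apply: subspaceP.
pose pL := GRing.isLinear.Build K E E *:%R p p_lin.
by exists (HB.pack_for (End E) p pL).
Qed.

Lemma direct_sum_idempotent V W : subspace V -> subspace W ->
  direct_sum V W -> exists P, [/\ P * P = P, range P = V & range (1 - P) = W].
Proof.
move=> sV sW dVW; have [P hP] := direct_sum_projection sV sW dVW.
have VW0 u : V u -> W u -> u = 0.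
  by move=> Vu Wu; have : (V `&` W) u by []; rewrite dVW.2.
have PV v : V v -> P v = v.
  move=> Vv; have [VP WP] := hP v; apply/eqP; rewrite -subr_eq0 -oppr_eq0 opprB.
  by apply/eqP/VW0 => //; apply: subspaceB.
have PW w : W w -> P w = 0.
  move=> Ww; have [VP WP] := hP w; apply: VW0 => //.
  by rewrite -[P w](subKr w); apply: subspaceB.
exists P; split.
- by apply: EndP => u; rewrite EndME PV //; case: (hP u).
- rewrite predeqE => v; split=> [[u _ <-]|Vv]; first by case: (hP u).
  by exists v; rewrite ?PV.
rewrite predeqE => w; split=> [[u _ <-]|Ww]; first by case: (hP u).
by exists w; rewrite // EndBE End1E PW ?subr0.
Qed.

Lemma idempotent_direct_sum P : P * P = P ->
  direct_sum (range P) (range (1 - P)).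
Proof.
move=> PP; split.
  rewrite predeqE => u; split=> // _; exists (P u); first by exists u.
  by exists ((1 - P) u); [exists u|rewrite EndBE End1E addrC addrNK].
rewrite predeqE => u; split=> [[[v _ <-] [w _ vw]]|->].
  by rewrite -PP EndME -vw -EndME mulrBr mulr1 PP subrr.
by split; exists 0; rewrite ?raddf0.
Qed.

Lemma span_map T s : span (map T s) = T @` span s.
Proof.
have E_sum (c : nat -> K) : \sum_(i < size (map T s)) c i *: (map T s)`_i =
    T (\sum_(i < size s) c i *: s`_i).
  rewrite size_map raddf_sum; apply: eq_bigr => i _.
  by rewrite (nth_map 0) //= linearZ.
rewrite predeqE => u; split=> [[c _ <-]|[_ [c _ <-] <-]]; last by exists c.
by exists (\sum_(i < size s) c i *: s`_i); [exists c|rewrite E_sum].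
Qed.

(** The kernel of [1 - P] is [range P], so [1 - P] embeds the quotient by [range P] into [E]. *)
Lemma fdim_quot_rangeP P T : P * P = P ->
  fdim_quot (sum_set (range T) (range P)) (range P) <->
  finite_rank ((1 - P) * T).
Proof.
move=> PP; rewrite sum_setC; split.
  move=> /(fdim_quot_sumP (subspace_range P))[s hs].
  apply/finite_rankP; exists (map (1 - P : End E) s) => u.
  have [|w sw [v _ Pv]] := hs (T u); first by exists u.
  have -> : ((1 - P) * T) u = (1 - P) w.
    apply/eqP; rewrite -subr_eq0 EndME -raddfB -Pv; apply/eqP.
    by rewrite -[LHS]/(((1 - P) * P) v) mulrBl mul1r PP subrr.
  by rewrite span_map; exists w.
move=> /finite_rankP[s hs].
apply: fdim_quot_sum; [exact: subspace_range..|].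
exists s => _ [u _ <-]; exists (((1 - P) * T) u) => //.
by exists (T u) => //; rewrite EndME EndBE End1E subKr.
Qed.

(** Going through [s], a vector is kept only if it lies outside the sum of [U] and the span of those
    already kept. If [s] spans modulo [U], the result spans a complement of [U]. *)
Lemma independent_span U s : subspace U -> exists t,
  U `&` span t = [set 0] /\ span s `<=` sum_set U (span t).
Proof.
move=> sU; have U0 := subspace0 sU.
elim: s => [|x s [t [Ut st]]].
  exists [::]; rewrite span_nilE; split=> [|_ ->].
    by rewrite predeqE => u; split=> [[]|->].
  by exists 0 => //; exists 0; rewrite ?addr0.
have sUt : subspace (sum_set U (span t)).
  exact: subspace_sum_set (subspace_span t).
have [Utx|nUtx] := pselect (sum_set U (span t) x).
  exists t; split=> // _ /span_consP[a [w [sw ->]]].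
  by apply: subspaceP => //; apply: st.
exists (x :: t); split=> [|_ /span_consP[a [w [/st[u Uu [v tv <-]] ->]]]].
  rewrite predeqE => u; split=> [[Uu]|->]; last first.
    by split=> //; apply: subspace0 (subspace_span _).
  move=> /span_consP[a [w [tw uE]]]; have [a0|a0] := eqVneq a 0.
    have : (U `&` span t) u by split=> //; rewrite uE a0 scale0r add0r.
    by rewrite Ut.
  (* Solving [u = a *: x + w] for [x] would put [x] in [U + span t]. *)
  case: nUtx; exists (a^-1 *: u); first exact: subspaceZ.
  exists (- a^-1 *: w); first exact: subspaceZ (subspace_span t) tw.
  by rewrite uE scalerDr scalerA mulVf // scale1r scaleNr addrK.
exists u => //; exists (a *: x + v); last by rewrite addrCA.
by apply/span_consP; exists a, v.
Qed.

(** Preimages [t] of vectors spanning [range N] span [E] modulo the kernel of [N]; thinned out, they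
    span a finite dimensional complement along which [Q] projects. *)
Lemma kernel_projection N : finite_rank N -> exists Q : End E,
  [/\ N * Q = 0, finite_rank (1 - Q) & forall u, N u = 0 -> Q u = u].
Proof.
move=> [s sN hs]; pose U := [set u | N u = 0].
have sU : subspace U.
  apply: subspaceI => [|a u v]; rewrite /U /= ?raddf0 // linearP => -> ->.
  by rewrite scaler0 addr0.
have [t st] : exists t, s = map N t.
  elim: s sN {hs} => [|x s IHs] sN; first by exists [::].
  have [y _ yx] := sN x (mem_head _ _).
  have [|t ->] := IHs; last by exists (y :: t); rewrite /= yx.
  by move=> z /= sz; apply: sN; rewrite /= inE sz orbT.
have ht u : exists2 w, span t w & U (u - w).
  have [|w] := hs (N u); first by exists u.
  rewrite st span_map => -[v tv <-] Nuv; exists v => //.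
  by rewrite /U /= raddfB.
have [r [Ur tr]] := independent_span t sU.
have [] := direct_sum_projection sU (subspace_span r).
  split=> //; rewrite predeqE => u; split=> // _.
  have [_ /tr[v Uv [w' rw' <-]] Uw] := ht u.
  exists (u - (v + w') + v); first exact: subspaceD.
  by exists w' => //; rewrite -addrA addrNK.
move=> Q hQ; exists Q; split.
- by apply: EndP => u; case: (hQ u).
- by apply/finite_rankP; exists r => u; case: (hQ u).
move=> u Nu; have [UQ rQ] := hQ u.
have : (U `&` span r) (u - Q u) by split=> //; apply: subspaceB.
by rewrite Ur => /eqP; rewrite subr_eq0 eq_sym => /eqP.
Qed.

End Projections.

(** * Idempotents modulo finite rank *)

Section IdempotentLift.
Variables (K : fieldType) (E : lmodType K).
Implicit Types P S T : End E.

Lemma idempotentC P : P * P = P -> (1 - P) * (1 - P) = 1 - P.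
Proof. by move=> PP; rewrite mulrBl mul1r mulrBr mulr1 PP subrr subr0. Qed.

Lemma idempotent_lift T : finite_rank (T * T - T) ->
  exists P, P * P = P /\ finite_rank (P - T).
Proof.
move=> /kernel_projection[Q [NQ Qfin Qid]].
have TTQ : T * (T * Q) = T * Q.
  by apply/eqP; rewrite -subr_eq0 mulrA -mulrBl NQ.
(* [T * Q] maps into the kernel of [T * T - T], where [Q] is the identity. *)
have QTQ : Q * (T * Q) = T * Q.
  apply: EndP => u; rewrite EndME; apply: Qid.
  by rewrite -EndME mulrBl -mulrA !TTQ subrr.
exists (T * Q); split; first by rewrite -mulrA QTQ.
by rewrite -[X in _ - X]mulr1 -mulrBr -opprB mulrN -mulNr; apply: finite_rankMl.
Qed.

(** Each product is a difference of the idempotents times one of them, as in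
    [(1 - P) * S = (S - P) * S]. The four products match the four quotients in [dec_equiv]. *)
Lemma finite_rank_idempotentB P S : P * P = P -> S * S = S ->
  finite_rank (P - S) <->
  [/\ finite_rank ((1 - P) * S), finite_rank ((1 - S) * P),
      finite_rank (P * (1 - S)) & finite_rank (S * (1 - P))].
Proof.
move=> PP SS; split=> [PSfin|[PS _ SP _]]; last first.
  have -> : P - S = P * (1 - S) - (1 - P) * S.
    by rewrite mulrBr mulrBl mulr1 mul1r opprB addrA addrNK.
  exact: finite_rankB.
have SPfin : finite_rank (S - P) by rewrite -opprB -mulN1r; apply: finite_rankMl.
split.
- by rewrite mulrBl mul1r -{1}SS -mulrBl; apply: finite_rankMr.
- by rewrite mulrBl mul1r -{1}PP -mulrBl; apply: finite_rankMr.
- by rewrite mulrBr mulr1 -{1}PP -mulrBr; apply: finite_rankMl.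
by rewrite mulrBr mulr1 -{1}SS -mulrBr; apply: finite_rankMl.
Qed.

End IdempotentLift.

(** * Decompositions as idempotents of the Fredholm extension *)

Section Endclasses.
Variables (K : fieldType) (A : algType K).
Implicit Types (P : End A) (T : tilde A) (D : decomposition A).

Lemma almost_invariant_rangeP P : P * P = P ->
  almost_invariant (range P) <->
  forall x, finite_rank ((1 - P) * (rmul x * P)).
Proof.
move=> PP.
have tr x : right_translate (range P) x = range (rmul x * P).
  rewrite predeqE => u; split=> [[_ [v _ <-] <-]|[v _ <-]]; first by exists v.
  by exists (P v); first by exists v.
split=> [[_ h] x|h]; first by apply/(fdim_quot_rangeP _ PP); rewrite -tr.
split; first exact: subspace_range.
by move=> x; rewrite tr; apply/fdim_quot_rangeP.
Qed.

Lemma tilde_idempotentP P : P * P = P ->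
  P \in @tilde_pred K A <->
  almost_invariant (range P) /\ almost_invariant (range (1 - P : End A)).
Proof.
move=> PP; have QQ := idempotentC PP.
rewrite (almost_invariant_rangeP PP) (almost_invariant_rangeP QQ) subKr.
split=> [/tildeP hP|[hP hQ]]; last first.
  apply/tildeP => x.
  have -> : P * rmul x - rmul x * P =
      P * (rmul x * (1 - P)) - (1 - P) * (rmul x * P).
    by rewrite mulrBr mulrBl mul1r mulr1 mulrBr opprB addrA addrNK.
  exact: finite_rankB.
split=> x.
  (* Multiplying the commutator by [1 - P] on the left kills [P * rmul x]; on the right it kills
     [rmul x * P]. *)
  have -> : (1 - P) * (rmul x * P) =
      (1 - P) * -1 * (P * rmul x - rmul x * P).
    by rewrite -mulrA mulN1r opprB mulrBr [_ * (P * _)]mulrA [(1 - P) * P]mulrBl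
      mul1r PP subrr mul0r subr0.
  exact: finite_rankMl.
have -> : P * (rmul x * (1 - P)) = (P * rmul x - rmul x * P) * (1 - P).
  by rewrite mulrBl -!mulrA [P * (1 - P)]mulrBr mulr1 PP subrr mulr0 subr0.
exact: finite_rankMr.
Qed.

(** A relation, so that it can be used both ways: each [D] has such a [T], and each idempotent [T]
    of infinite rank has such a [D]. *)
Definition projection_of T D :=
  [/\ val T * val T = val T, dec1 D = range (val T) &
      dec2 D = range (1 - val T : End A)].

Lemma projection_of_exists D : exists T, projection_of T D.
Proof.
have [s1 _] := dec1_almost_invariant D; have [s2 _] := dec2_almost_invariant D.
have [P [PP r1 r2]] := direct_sum_idempotent s1 s2 (dec_direct_sum D).
have tP : P \in @tilde_pred K A.
  apply/(tilde_idempotentP PP); rewrite r1 r2.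
  by split; [exact: dec1_almost_invariant|exact: dec2_almost_invariant].
by exists (exist _ P tP); split.
Qed.

Lemma decomposition_of_exists T : val T * val T = val T ->
  ~ finite_rank (val T) -> exists D, projection_of T D.
Proof.
move=> TT nT; have [i1 i2] := (tilde_idempotentP TT).1 (valP T).
by exists (Decomposition i1 i2 (idempotent_direct_sum TT) nT); split.
Qed.

(** This is where infinite dimension of the first summand turns into a nonzero class in [Fred A]. *)
Lemma projection_of_neq0 T D : projection_of T D -> ~ finite_rank (val T).
Proof. by case=> _ d1 _; rewrite /finite_rank -d1; apply: dec1_infinite. Qed.

Lemma dec_equivP T T' D D' : projection_of T D -> projection_of T' D' ->
  dec_equiv D D' <-> \pi_(Fred A) T = \pi_(Fred A) T'.
Proof.
move=> [TT d1 d2] [TT' d1' d2'].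
have CC := idempotentC TT; have CC' := idempotentC TT'.
have -> : (\pi_(Fred A) T = \pi_(Fred A) T') <-> finite_rank (val T - val T').
  by split=> [/eqP/Fred_eqP|/Fred_eqP/eqP].
rewrite /dec_equiv d1 d2 d1' d2' (finite_rank_idempotentB TT TT').
have fdimr (P R : End A) (PP : P * P = P) := propext (fdim_quot_rangeP R PP).
have fdiml (P R : End A) (PP : P * P = P) :
    fdim_quot (sum_set (range P) (range R)) (range P) =
    finite_rank ((1 - P) * R) by rewrite sum_setC fdimr.
by rewrite (fdiml _ _ TT) (fdimr _ _ TT') (fdiml _ _ CC) (fdimr _ _ CC') !subKr.
Qed.

Lemma Fred_eq0P T : reflect (finite_rank (val T)) (\pi_(Fred A) T == 0).
Proof.
have -> : (0 : Fred A) = \pi_(Fred A) 0 by rewrite piE.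
by apply: (iffP (Fred_eqP T 0)); rewrite (raddf0 val) subr0.
Qed.

Lemma projection_of_idempotent T D : projection_of T D ->
  (\pi_(Fred A) T != 0) && (\pi_(Fred A) T * \pi_(Fred A) T == \pi_(Fred A) T).
Proof.
move=> TD; apply/andP; split.
  by apply/negP => /Fred_eq0P; apply: projection_of_neq0 TD.
by rewrite -[X in X == _]pi_FredM; case: TD => TT _ _; apply/Fred_eqP;
  rewrite rmorphM /= TT subrr; apply: finite_rank0.
Qed.

Lemma nonzero_idempotent_lift (e : Fred A) : e != 0 -> e * e == e ->
  exists T D, projection_of T D /\ e = \pi_(Fred A) T.
Proof.
have [S ->] := Fred_surj e => S0 /eqP SS.
have Sfin : finite_rank (val S * val S - val S).
  by rewrite -rmorphM; apply/Fred_eqP; rewrite pi_FredM; apply/eqP.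
have [P [PP PSfin]] := idempotent_lift Sfin.
have tP : P \in @tilde_pred K A.
  (* [P] is a finite rank perturbation of [val S]. *)
  rewrite -[P](subrK (val S)).
  by apply: rpredD (valP S); apply: finite_rank_tilde.
pose T : tilde A := exist _ P tP.
have ST : \pi_(Fred A) S = \pi_(Fred A) T by apply/esym/eqP/Fred_eqP.
have [|D TD] := @decomposition_of_exists T PP.
  by move=> /Fred_eq0P; apply/negP; rewrite -ST.
by exists T, D.
Qed.

End Endclasses.

(** * The bijection with endclasses *)

Theorem theorem1 (K : fieldType) (A : algType K) (hA : countable_dim A) :
  exists f : nonzero_idempotent A -> endclass A, bijective f.
Proof.
have [p hp] := choice (@projection_of_exists K A).
pose g D : nonzero_idempotent A :=
  exist _ (\pi_(Fred A) (p D)) (projection_of_idempotent (hp D)).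
(* Thus [g] descends to endclasses and is injective there. *)
have g_eq D D' : g D = g D' <-> \pi_(endclass A) D = \pi_(endclass A) D'.
  transitivity (dec_equiv D D').
    rewrite (dec_equivP (hp D) (hp D')); split=> [/(congr1 val)//|eD].
    exact: val_inj.
  by split=> [h|/eqquotP/asboolP//]; apply/eqquotP/asboolP.
have g_surj e : exists D, g D = e.
  case: e => e e_idem; have /andP[e0 ee] := e_idem.
  have [T [D [TD eT]]] := nonzero_idempotent_lift e0 ee.
  exists D; apply: val_inj; rewrite /= eT.
  (* [p D] and [T] are projections for the same [D], so reflexivity of [dec_equiv] makes them
     congruent. *)
  apply/(dec_equivP (hp D) TD)/asboolP.
  exact: (@equiv_refl _ (@dec_equiv_rel K A) D).
have [h gh] := choice g_surj.
(* The section [h] of [g] gives the map, and [g] on representatives its inverse. *)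
exists (fun e => \pi_(endclass A) (h e)).
exists (fun c => g (repr c)) => [e|c].
  by rewrite -[RHS]gh; apply/g_eq; rewrite reprK.
by rewrite -[RHS]reprK; apply/g_eq; rewrite gh.
Qed.
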